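(* Let $k$ and $i$ be integers with $1\le i\le k/2$ and $k\equiv i\equiv 0\pmod 3$. Then for all integers $n\ge 0$, $$S_{k,i}(3n+2)\equiv 0\pmod 4.$$
   Context: Write $(a;q)_\infty=\prod_{m\ge 0}(1-aq^m)$, $(a)_\infty=(a;q)_\infty$, and $(a_1,\ldots,a_r;q)_\infty=(a_1;q)_\infty\cdots(a_r;q)_\infty$. For integers $k,i$ with $1\le i\le k/2$, the integers $S_{k,i}(n)$, $n\ge 0$, are given by the generating function $$\sum_{n\ge 0}S_{k,i}(n)q^n=\frac{(-q)_\infty\,(q^i,q^{k-i},q^k;q^k)_\infty}{(q)_\infty}.$$ Combinatorially (an overpartition of $n$ is a partition of $n$ in which the first occurrence of each integer may be overlined): if $i<k/2$, $S_{k,i}(n)$ is the number of overpartitions of $n$ whose non-overlined parts are not congruent to $0,\pm i$ modulo $k$; if $i=k/2$, it is the number of overpartitions of $n$ with no part divisible by $k/2$. *)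

(* Defs.v *)
(* MathComp; formal power series over int are coefficient functions nat -> int. *)
From mathcomp Require Import all_boot all_order all_algebra.

Set Implicit Arguments.
Unset Strict Implicit.
Unset Printing Implicit Defensive.

Import GRing.Theory.
Local Open Scope ring_scope.

Definition fps := nat -> int.

Definition fps_one : fps := fun n => (n == 0%N)%:R.

Definition fps_mul (f g : fps) : fps :=
  fun n => \sum_(j < n.+1) f j * g (n - j)%N.

Definition fps_trunc (n : nat) (f : fps) : {poly int} := \poly_(j < n.+1) f j.

(* 1 / f = \sum_m (1 - f) ^ m, meaningful when f has constant term 1: the terms
   with m > n then do not contribute to the coefficient of q ^ n, nor do the
   coefficients of f of index > n (see fps_mulVr). *)
Definition fps_inv (f : fps) : fps :=
  fun n => (\sum_(m < n.+1) (1 - fps_trunc n f) ^+ m)`_n.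

Definition fps_div (f g : fps) : fps := fps_mul f (fps_inv g).

(* (a; b)_oo = \prod_(m >= 0) (1 - a * b ^ m), where the indeterminate q is 'X,
   meaningful when b has zero constant term: the partial products with more
   than n factors then all have the same coefficient of q ^ n (see qpoch_lim). *)
Definition qpoch (a b : {poly int}) : fps :=
  fun n => (\prod_(m < n.+1) (1 - a * b ^+ m))`_n.

(* (a_1, ..., a_r; b)_oo *)
Definition qpochs (s : seq {poly int}) (b : {poly int}) : fps :=
  foldr (fun a f => fps_mul (qpoch a b) f) fps_one s.

Definition S_ (k i : nat) : fps :=
  fps_div (fps_mul (qpoch (- 'X) 'X) (qpochs [:: 'X^i; 'X^(k - i); 'X^k] 'X^k))
          (qpoch 'X 'X).

Lemma coef_exp_small (p : {poly int}) (m n : nat) :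
  p`_0 = 0 -> (n < m)%N -> (p ^+ m)`_n = 0.
Proof.
move=> p0; elim: m n => // m IHm n lt_n_m.
rewrite exprS coefM big1 // => -[[|j] /= lt_jn] _; first by rewrite p0 mul0r.
case: n lt_jn lt_n_m => // n _ lt_nm.
by rewrite IHm ?mulr0 // subSS (leq_ltn_trans (leq_subr _ _)).
Qed.

Lemma qpoch_lim (a b : {poly int}) (n N : nat) : b`_0 = 0 -> (n < N)%N ->
  (\prod_(m < N) (1 - a * b ^+ m))`_n = qpoch a b n.
Proof.
move=> b0; elim: N => // N IHN; rewrite ltnS leq_eqVlt => /predU1P[-> //|lt_nN].
rewrite big_ord_recr /= mulrBr mulr1 coefB IHN // mulrA coefM big1 ?subr0 //.
move=> j _; rewrite (coef_exp_small b0) ?mulr0 //.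
exact: leq_ltn_trans (leq_subr _ _) lt_nN.
Qed.

Lemma fps_mul_trunc (f g : fps) (n N : nat) : (n <= N)%N ->
  fps_mul f g n = (fps_trunc N f * fps_trunc N g)`_n.
Proof.
move=> le_nN; rewrite coefM; apply: eq_bigr => j _; rewrite !coef_poly !ltnS.
by rewrite (leq_trans (leq_subr _ _) le_nN) (leq_trans _ le_nN) // -ltnS.
Qed.

Lemma coefM_eq (p p' r : {poly int}) (n : nat) :
  (forall j, (j <= n)%N -> p`_j = p'`_j) -> (p * r)`_n = (p' * r)`_n.
Proof.
by move=> eq_p; rewrite !coefM; apply: eq_bigr => j _; rewrite eq_p // -ltnS.
Qed.

Lemma fps_mulC (f g : fps) : fps_mul f g =1 fps_mul g f.
Proof. by move=> n; rewrite !(fps_mul_trunc _ _ (leqnn n)) mulrC. Qed.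

Lemma fps_mulA (f g h : fps) :
  fps_mul f (fps_mul g h) =1 fps_mul (fps_mul f g) h.
Proof.
move=> n; rewrite !(fps_mul_trunc _ _ (leqnn n)).
have truncM u v j : (j <= n)%N ->
    (fps_trunc n (fps_mul u v))`_j = (fps_trunc n u * fps_trunc n v)`_j.
  by move=> le_jn; rewrite coef_poly ltnS le_jn; apply: fps_mul_trunc.
by rewrite mulrC (coefM_eq _ (truncM g h)) (coefM_eq _ (truncM f g)) mulrC mulrA.
Qed.

Lemma coef_exp_eq (p p' : {poly int}) (n m : nat) :
  (forall j, (j <= n)%N -> p`_j = p'`_j) ->
  forall j, (j <= n)%N -> (p ^+ m)`_j = (p' ^+ m)`_j.
Proof.
move=> eq_p; elim: m => // m IHm j le_jn; rewrite !exprS.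
rewrite (@coefM_eq _ p') => [|l le_lj]; last exact/eq_p/(leq_trans le_lj).
rewrite mulrC [in RHS]mulrC; apply: coefM_eq => l le_lj.
exact/IHm/(leq_trans le_lj).
Qed.

Lemma fps_mulVr (f : fps) : f 0%N = 1 -> fps_mul f (fps_inv f) =1 fps_one.
Proof.
move=> f0 n; pose p := fps_trunc n f.
have p0 : (1 - p)`_0 = 0 by rewrite coefB coef1 coef_poly /= f0 subrr.
have invE j : (j <= n)%N ->
    (fps_trunc n (fps_inv f))`_j = (\sum_(m < n.+1) (1 - p) ^+ m)`_j.
  move=> le_jn; rewrite coef_poly ltnS le_jn /fps_inv !coef_sum.
  rewrite -[RHS](big_mkord xpredT (fun m => ((1 - p) ^+ m)`_j)).
  rewrite (big_cat_nat (n := j.+1)) //= [X in _ = _ + X]big_nat_cond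
    [X in _ = _ + X]big1.
    rewrite addr0 big_mkord; apply: eq_bigr => m _.
    apply: (@coef_exp_eq _ _ j) => // l le_lj.
    by rewrite !coefB !coef_poly !ltnS le_lj (leq_trans le_lj).
  by move=> m /andP[/andP[lt_jm _] _]; apply: coef_exp_small.
rewrite (fps_mul_trunc _ _ (leqnn n)) mulrC (coefM_eq _ invE) mulrC -/p.
have -> : p * \sum_(m < n.+1) (1 - p) ^+ m = 1 - (1 - p) ^+ n.+1.
  by apply: oppr_inj; rewrite opprB subrX1 -mulNr addrAC subrr add0r.
by rewrite coefB coef1 (coef_exp_small p0) // subr0.
Qed.

(* The generating function identity with the denominator cleared. *)
Lemma S_gf (k i : nat) : fps_mul (S_ k i) (qpoch 'X 'X) =1
  fps_mul (qpoch (- 'X) 'X) (qpochs [:: 'X^i; 'X^(k - i); 'X^k] 'X^k).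
Proof.
move=> n; rewrite /S_ /fps_div -fps_mulA.
set F := fps_mul (qpoch _ _) _; set d := qpoch 'X 'X.
have d0 : d 0%N = 1.
  by rewrite /d /qpoch big_ord1 expr0 mulr1 coefB coef1 coefX subr0.
rewrite /fps_mul big_ord_recr /= subnn big1 ?add0r => [|j _].
  by have := fps_mulVr d0 0; rewrite fps_mulC /fps_mul => ->; rewrite mulr1.
have := fps_mulVr d0 (n - j)%N; rewrite fps_mulC /fps_mul /fps_one => ->.
by rewrite subn_eq0 leqNgt ltn_ord mulr0.
Qed.

(* Main.v *)
Require Import Defs.
From mathcomp Require Import all_boot all_order all_algebra.
From mathcomp Require Import zify ring.

(** Modulo 4, (1 + q^m) / (1 - q^m) = 1 + 2 (q^m + q^(2m) + ...), and the cross
    terms of the product over m vanish, so (-q)_oo / (q)_oo is congruent to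
    1 + 2 \sum_n d(n) q^n with d(n) the number of divisors of n.  If n = 2 mod 3
    then n is not a square and d(n) is even.  Since 3 divides k and i, the
    remaining factor (q^i, q^(k-i), q^k; q^k)_oo is a series in q^3, so the
    coefficients of q^(3n+2) in the product vanish modulo 4. *)

Section OverpartitionsModFour.

Import GRing.Theory.
Local Open Scope ring_scope.

(** The off-diagonal terms pair up under the swap of [m] and [j]. *)
Lemma sum_sym_even (f : nat -> nat -> int) (N : nat) :
    (forall m j, f m j = f j m) -> (forall m, f m m = 0) ->
  (2 %| \sum_(m < N) \sum_(j < N) f m j)%Z.
Proof.
move=> f_sym f_diag; elim: N => [|N IHN]; first by rewrite big_ord0.
rewrite big_ord_recr /=.
under eq_bigr do rewrite big_ord_recr /=.
rewrite big_split big_ord_recr /= f_diag addr0 -addrA rpredD //.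
rewrite [X in (_ %| X + _)%Z](eq_bigr (fun j : 'I_N => f N j)) => [|j _ //].
by apply/dvdzP; exists (\sum_(j < N) f N j); rewrite mulr_natr.
Qed.

(* The truncation of \sum_m q^m / (1 - q^m), the generating function of the
   number of divisors, to the terms q^(m j) with m <= M and j <= N. *)
Definition lambert (M N : nat) : {poly int} :=
  \sum_(m < M) \sum_(j < N) 'X^(m.+1 * j.+1).

Lemma lambert_coef_even (N r : nat) : r = 2 %[mod 3] -> (2 %| (lambert N N)`_r)%Z.
Proof.
move=> r2; rewrite /lambert coef_sum.
under eq_bigr do rewrite coef_sum.
apply: (sum_sym_even (fun m j => ('X^(m.+1 * j.+1) : {poly int})`_r)) => m.
  by move=> j; rewrite mulnC.
rewrite coefXn; case: eqP => // r_sq; move: r2.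
(* A diagonal term would make [r] a square, but squares are 0 or 1 modulo 3. *)
have : (m.+1 %% 3)%N \in [:: 0; 1; 2]%N.
  by have := ltn_pmod m.+1 (isT : (0 < 3)%N); rewrite !inE; lia.
by rewrite r_sq -modnMm !inE => /or3P[] /eqP->.
Qed.

Lemma geometric_sumE (m N : nat) :
  (1 - 'X^m) * \sum_(j < N) 'X^(m * j.+1) = 'X^m - 'X^(m * N.+1) :> {poly int}.
Proof.
elim: N => [|N IHN]; first by rewrite big_ord0 mulr0 muln1 subrr.
rewrite big_ord_recr mulrDr IHN /= [(m * N.+2)%N]mulnS exprD; ring.
Qed.

(** A division-free form of the congruence for (-q)_oo / (q)_oo: [U] collects the cross terms, [V]
    the tails of the truncated geometric sums. *)
Lemma qpoch_quotient_mod4 (M N : nat) : exists U V : {poly int},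
  \prod_(m < M) (1 - - 'X * 'X ^+ m) =
  \prod_(m < M) (1 - 'X * 'X ^+ m) * (1 + 2 * lambert M N)
    + 4 * U + 'X^(N.+1) * V.
Proof.
elim: M => [|M [U [V IHM]]].
  by exists 0, 0; rewrite /lambert !big_ord0; ring.
rewrite /lambert !big_ord_recr /= IHM -/(lambert M N).
set A := \prod_(m < M) _; set D := lambert M N.
have := geometric_sumE M.+1 N; set L := \sum_(j < N) _ => eqL.
have eqX : 'X^(M.+1 * N.+1) = 'X^(M * N.+1) * 'X^(N.+1) :> {poly int}.
  by rewrite mulSn addnC exprD.
(* With x = q^(M+1), writing 1 + x = (1 - x) + 2x in A(1 + 2D)(1 + x) produces the cross term 4AxD;
   replacing 2Ax by 2A(1 - x)L leaves the tail 2Ax^(N+1). *)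
exists (U * (1 + 'X^(M.+1)) + A * 'X^(M.+1) * D).
exists (V * (1 + 'X^(M.+1)) + 2 * A * 'X^(M * N.+1)).
rewrite mulNr opprK -exprS.
have -> : A * (1 - 'X^(M.+1)) * (1 + 2 * (D + L)) =
   A * (1 - 'X^(M.+1)) * (1 + 2 * D) + 2 * A * ((1 - 'X^(M.+1)) * L) by ring.
rewrite eqL eqX; ring.
Qed.

(** Since [a] has constant term 1, the j-th coefficient of [p * a] is that of [p] plus a combination
    of earlier ones, so strong induction applies. *)
Lemma dvdz_coef_cancel (d : int) (p a : {poly int}) (N : nat) : a`_0 = 1 ->
  (forall j, (j <= N)%N -> (d %| (p * a)`_j)%Z) ->
  forall j, (j <= N)%N -> (d %| p`_j)%Z.
Proof.
move=> a0 dvd_pa; elim/ltn_ind=> j IHj le_jN; have := dvd_pa j le_jN.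
rewrite coefM big_ord_recr /= subnn a0 mulr1 rpredDl //.
apply: rpred_sum => l _; apply/dvdz_mulr/IHj => //.
exact: leq_trans (ltnW (ltn_ord l)) le_jN.
Qed.

(** These are the power series in q^d. *)
Definition supported_on_multiples (d : nat) (f : fps) : Prop :=
  forall n, ~~ (d %| n)%N -> f n = 0.

Lemma supported_fps_mul (d : nat) (f g : fps) :
  supported_on_multiples d f -> supported_on_multiples d g ->
  supported_on_multiples d (fps_mul f g).
Proof.
move=> f_d g_d n n_d; apply: big1 => j _.
have [j_d|/f_d->] := boolP (d %| j)%N; last by rewrite mul0r.
rewrite g_d ?mulr0 //; apply: contra n_d => nj_d.
by rewrite -(subnKC (_ : j <= n)%N) ?dvdn_add // -ltnS.
Qed.

Lemma supported_qpoch (d a b : nat) : (d %| a)%N -> (d %| b)%N ->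
  supported_on_multiples d (qpoch 'X^a 'X^b).
Proof.
(* The number of factors is decoupled from the coefficient index to allow induction on it. *)
move=> d_a d_b n; rewrite /qpoch; move: n.+1 => M.
elim: M n => [|M IHM] n n_d.
  by rewrite big_ord0 coef1; case: eqP n_d => // ->; rewrite dvdn0.
rewrite big_ord_recr /= coefM.
apply: (supported_fps_mul _ _ (fun j => (1 - 'X^a * 'X^b ^+ M)`_j) IHM) n_d => j.
rewrite coefB coef1 -exprM -exprD coefXn.
case: (j =P 0%N) => [->|_]; first by rewrite dvdn0.
by case: eqP => // ->; rewrite dvdn_add ?dvdn_mulr.
Qed.

Lemma supported_qpochs (d b : nat) (s : seq nat) :
    (d %| b)%N -> all (dvdn d) s ->
  supported_on_multiples d (qpochs [seq 'X^a | a <- s] 'X^b).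
Proof.
move=> d_b; elim: s => [|a s IHs] /= => [_ n|/andP[d_a /IHs d_s]].
  by rewrite /fps_one; case: eqP => // ->; rewrite dvdn0.
exact: supported_fps_mul (supported_qpoch _ _ _ d_a d_b) d_s.
Qed.

Lemma S_mod4 (k i N : nat) :
  let t := fps_trunc N (qpochs [:: 'X^i; 'X^(k - i); 'X^k] 'X^k) in
  (S_ k i N = ((1 + 2 * lambert N.+1 N.+1) * t)`_N %[mod 4])%Z.
Proof.
move=> t; have [U [V]] := qpoch_quotient_mod4 N.+1 N.+1.
set A := \prod_(m < _) (1 - 'X * _); set B := \prod_(m < _) _.
set D := lambert _ _ => eqB; pose s := fps_trunc N (S_ k i).
have coef_trunc (c : {poly int}) j : (j <= N)%N ->
    (fps_trunc N (qpoch c 'X))`_j = (\prod_(m < N.+1) (1 - c * 'X ^+ m))`_j.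
  by move=> le_jN; rewrite coef_poly ltnS le_jN (@qpoch_lim _ _ j) ?coefX.
have A0 : A`_0 = 1.
  by rewrite (@qpoch_lim _ _ 0) ?coefX // /qpoch big_ord1 mulr1 coefB coef1 coefX.
(* By [S_gf], [s * A] and [B * t] agree up to degree [N]; after expanding [B] by [eqB], what remains
   is a multiple of 4 and a multiple of q^(N+2), invisible in these degrees. *)
have dvd_coefA j : (j <= N)%N -> (4 %| ((s - (1 + 2 * D) * t) * A)`_j)%Z.
  move=> le_jN.
  have coef_trunc_le c l (le_lj : (l <= j)%N) := coef_trunc c l (leq_trans le_lj le_jN).
  have eq_sA : (s * A)`_j = (B * t)`_j.
    rewrite mulrC -(coefM_eq s (coef_trunc_le _)) mulrC.
    rewrite -(coefM_eq t (coef_trunc_le _)) -!(fps_mul_trunc _ _ le_jN).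
    exact: S_gf.
  rewrite mulrBl coefB eq_sA -coefB eqB.
  have -> : (A * (1 + 2 * D) + 4 * U + 'X^(N.+2) * V) * t - (1 + 2 * D) * t * A =
    (U * t) * 4%:R + 'X^(N.+2) * (V * t) by ring.
  rewrite coefD coefXnM ltnS (leqW le_jN) addr0 mulr_natr coefMn.
  by apply/dvdzP; exists (U * t)`_j; rewrite mulr_natr.
have := dvdz_coef_cancel 4 _ _ N A0 dvd_coefA N (leqnn N).
by rewrite coefB coef_poly ltnSn -eqz_mod_dvd => /eqP.
Qed.

Lemma S_mod4_of_dvd3 (k i N : nat) : (3 %| i)%N -> (3 %| k)%N -> N = 2 %[mod 3] ->
  (4 %| S_ k i N)%Z.
Proof.
move=> i3 k3 N2; rewrite -[S_ k i N]subr0 -eqz_mod_dvd S_mod4 eqz_mod_dvd subr0.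
set t := fps_trunc _ _; set D := lambert _ _.
have t0 j : (j <= N)%N -> ~~ (3 %| j)%N -> t`_j = 0.
  move=> le_jN; rewrite coef_poly ltnS le_jN.
  by apply: (supported_qpochs 3 k [:: i; (k - i)%N; k]); rewrite //= i3 dvdn_sub // k3.
(* The summand 1 contributes the coefficient of q^N in [t], which is 0 as 3 does not divide [N]. *)
rewrite mulrDl mul1r coefD t0 ?add0r //; last first.
  by rewrite /dvdn N2.
have -> : (2 * D * t)`_N = 2 * (D * t)`_N by rewrite -mulrA !mulr_natl coefMn.
rewrite (_ : 4 = 2 * 2) // dvdz_mul2l //.
rewrite coefM; apply: rpred_sum => j _.
(* Only indices with [j] congruent to [N], hence to 2, modulo 3 survive, and there the coefficient
   of [D] is even. *)
have [N_j|/t0->] := boolP (3 %| N - j)%N; rewrite ?mulr0 ?leq_subr //.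
apply/dvdz_mulr/lambert_coef_even.
have le_jN : (j <= N)%N by rewrite -ltnS.
by rewrite -N2 -[in RHS](subnKC le_jN) -modnDmr (eqP N_j) addn0.
Qed.

End OverpartitionsModFour.

Theorem mainTheorem3 (k i : nat) (hi : 1 <= i) (hik : 2 * i <= k)
    (hk3 : k = 0 %[mod 3]) (hi3 : i = 0 %[mod 3]) (n : nat) :
  (S_ k i (3 * n + 2)%N = 0 %[mod 4])%Z.
Proof.
rewrite mod0z; apply/dvdz_mod0P/S_mod4_of_dvd3; rewrite /dvdn ?hi3 ?hk3 //.
by rewrite mulnC modnMDl.
Qed.
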